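(* Let $M$ be the monoid defined by a finite special presentation $\langle A\mid w_1=1,\ldots,w_k=1\rangle$. Let $\Gamma$ be the directed graph obtained from the right Cayley graph $\Gamma(M,A)$ by collapsing each strongly connected component (and its internal edges) to a point. Then $\Gamma$ is isomorphic as a digraph to the Hasse diagram of $M/\mathscr{R}$ ordered by $\geq_{\mathscr R}$. This graph is a regular rooted tree with root the strongly connected component of $1$.
   Context: The right Cayley graph $\Gamma(M,A)$ has vertex set $M$ and, for each $(m,a)\in M\times A$, a directed edge from $m$ to $ma$. Two vertices of a digraph lie in the same strongly connected component if there are directed paths from each to the other. For $m,n\in M$ write $m\leq_{\mathscr R} n$ if $mM\subseteq nM$, and $m\mathrel{\mathscr R}n$ if $mM=nM$; $R_m$ denotes the $\mathscr R$-class of $m$. The strongly connected components of $\Gamma(M,A)$ have the $\mathscr R$-classes as vertex sets, and $M/\mathscr R$ is a poset under the order induced by $\leq_{\mathscr R}$. Explicitly, $\Gamma$ has vertex set $M/\mathscr R$ and, for each pair $(m,a)\in M\times A$ with $R_m\neq R_{ma}$, an edge from $R_m$ to $R_{ma}$. The Hasse diagram of $M/\mathscr R$ ordered by $\geq_{\mathscr R}$ has an edge from $R_m$ to $R_n$ exactly when $R_m$ covers $R_n$, i.e. $R_n<_{\mathscr R}R_m$ and no $\mathscr R$-class lies strictly between them. A rooted tree is called regular here if all its vertices have the same cardinality of children (possibly infinite). *)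

(* Defs.v *)
From HB Require Import structures.
From mathcomp Require Import all_boot all_order.
From mathcomp Require Import boolp classical_sets functions cardinality.

Set Implicit Arguments.
Unset Strict Implicit.
Unset Printing Implicit Defensive.

Import Order.TTheory.

Local Open Scope classical_set_scope.
Local Open Scope quotient_scope.
Local Open Scope group_scope.

(* Digraphs may have loops and parallel edges: edges form a type of their own. *)
Record digraph := Digraph {
  vertex : choiceType;
  edge : Type;
  source : edge -> vertex;
  target : edge -> vertex
}.

Section Digraph.
Variable G : digraph.
Implicit Types (u v : vertex G) (e : edge G) (p : seq (edge G)).

(* p is the list of consecutive edges of a directed path from u to v. *)
Fixpoint dipath u p v : Prop :=
  match p with
  | [::] => u = v
  | e :: p' => source e = u /\ dipath (target e) p' v
  end.

Definition reaches u v : Prop := exists p, dipath u p v.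

Definition strongly_connected u v : bool := `[< reaches u v /\ reaches v u >].

Lemma dipath_cat u v w p q : dipath u p v -> dipath v q w -> dipath u (p ++ q) w.
Proof. by elim: p u => [u -> //|e p IHp u /= [-> /IHp h] /h]. Qed.

Lemma strongly_connected_refl : reflexive strongly_connected.
Proof. by move=> u; apply/asboolP; split; exists [::]. Qed.

Lemma strongly_connected_sym : symmetric strongly_connected.
Proof. by move=> u v; apply/asboolP/asboolP => -[]. Qed.

Lemma strongly_connected_trans : transitive strongly_connected.
Proof.
move=> v u w /asboolP[[p up] [p' pu]] /asboolP[[q vq] [q' qv]].
apply/asboolP; split; [exists (p ++ q)|exists (q' ++ p')].
  exact: dipath_cat up vq.
exact: dipath_cat qv pu.
Qed.

Canonical strongly_connected_equiv :=
  EquivRel strongly_connected strongly_connected_refl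
    strongly_connected_sym strongly_connected_trans.

Definition scc_type := {eq_quot strongly_connected}.

Definition scc u : scc_type := \pi_scc_type u.

(* Only the internal edges of the components are discarded; parallel edges    *)
(* between two components are not merged.                                     *)
Definition condensation : digraph :=
  @Digraph scc_type {e : edge G | scc (source e) != scc (target e)}
    (fun x => scc (source (sval x))) (fun x => scc (target (sval x))).

Definition children u : set (vertex G) :=
  [set v | exists e, source e = u /\ target e = v].

(* Exactly one directed path leads from the root r to each vertex; for v = r   *)
(* this is the empty path, so no directed cycle passes through r.              *)
Definition rooted_tree (r : vertex G) : Prop :=
  forall v, exists! p, dipath r p v.

Definition regular_rooted_tree (r : vertex G) : Prop :=
  rooted_tree r /\ forall u v, (children u #= children v)%card.

End Digraph.

Definition digraph_isomorphic (G H : digraph) : Prop :=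
  exists (f : vertex G -> vertex H) (g : edge G -> edge H),
    [/\ bijective f, bijective g,
        forall e, source (g e) = f (source e)
      & forall e, target (g e) = f (target e)].

Section HasseDiagram.
Variables (d : Order.disp_t) (P : porderType d).
Local Open Scope order_scope.

Definition covers (x y : P) : Prop :=
  y < x /\ ~ exists z : P, y < z /\ z < x.

(* The Hasse diagram of P ordered by >=: edges point downwards for <=. *)
Definition hasse_ge : digraph :=
  @Digraph P {xy : P * P | covers xy.1 xy.2}
    (fun e => (sval e).1) (fun e => (sval e).2).

End HasseDiagram.

Section GreenR.
Variable M : monoidType.
Implicit Types m n : M.

Definition right_ideal m : set M := range (fun x => m * x).

Definition Rrel m n : bool := `[< right_ideal m = right_ideal n >].

Lemma Rrel_refl : reflexive Rrel.
Proof. by move=> m; apply/asboolP. Qed.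

Lemma Rrel_sym : symmetric Rrel.
Proof. by move=> m n; apply/asboolP/asboolP => ->. Qed.

Lemma Rrel_trans : transitive Rrel.
Proof. by move=> n m p /asboolP mn /asboolP np; apply/asboolP; rewrite mn. Qed.

Canonical Rrel_equiv := EquivRel Rrel Rrel_refl Rrel_sym Rrel_trans.

Definition Rquot := {eq_quot Rrel}.

HB.instance Definition _ := Choice.on Rquot.
HB.instance Definition _ := EqQuotient.on Rquot.

Definition Rclass m : Rquot := \pi_Rquot m.

Lemma RclassP m n : reflect (right_ideal m = right_ideal n) (Rclass m == Rclass n).
Proof. by rewrite eqmodE; exact: asboolP. Qed.

Lemma right_ideal_repr m : right_ideal (repr (Rclass m)) = right_ideal m.
Proof. by apply/RclassP; rewrite /Rclass reprK. Qed.

(* By Rclass_le below, the choice of representatives is immaterial. *)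
Definition Rle (x y : Rquot) : bool :=
  `[< right_ideal (repr x) `<=` right_ideal (repr y) >].

Lemma Rle_refl : reflexive Rle.
Proof. by move=> x; apply/asboolP. Qed.

Lemma Rle_anti : antisymmetric Rle.
Proof.
move=> x y /andP[/asboolP xy /asboolP yx].
rewrite -[x]reprK -[y]reprK; apply/eqP/RclassP.
by apply/seteqP; split.
Qed.

Lemma Rle_trans : transitive Rle.
Proof.
by move=> y x z /asboolP xy /asboolP yz; apply/asboolP; exact: subset_trans yz.
Qed.

Fact R_display : Order.disp_t. Proof. exact: Order.Disp tt tt. Qed.

HB.instance Definition _ :=
  Order.Le_isPOrder.Build R_display Rquot Rle_refl Rle_anti Rle_trans.

Lemma Rclass_le m n :
  (Rclass m <= Rclass n)%O = `[< right_ideal m `<=` right_ideal n >].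
Proof. by rewrite /Order.le /= /Rle !right_ideal_repr. Qed.

End GreenR.

Definition right_cayley (M : monoidType) (A : Type) (g : A -> M) : digraph :=
  @Digraph M (M * A)%type (fun ma => ma.1) (fun ma => ma.1 * g ma.2).

Section PresentedMonoid.
Variables (A : finType) (rels : seq (seq A * seq A)).
Implicit Types u v w : seq A.

Inductive pres_cong : seq A -> seq A -> Prop :=
| pres_cong_rel u v : (u, v) \in rels -> pres_cong u v
| pres_cong_refl u : pres_cong u u
| pres_cong_sym u v : pres_cong u v -> pres_cong v u
| pres_cong_trans u v w : pres_cong u v -> pres_cong v w -> pres_cong u w
| pres_cong_cat u u' v v' :
    pres_cong u u' -> pres_cong v v' -> pres_cong (u ++ v) (u' ++ v').

Definition pres_eq u v : bool := `[< pres_cong u v >].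

Lemma pres_eq_refl : reflexive pres_eq.
Proof. by move=> u; apply/asboolP; exact: pres_cong_refl. Qed.

Lemma pres_eq_sym : symmetric pres_eq.
Proof. by move=> u v; apply/asboolP/asboolP; exact: pres_cong_sym. Qed.

Lemma pres_eq_trans : transitive pres_eq.
Proof.
move=> v u w /asboolP uv /asboolP vw; apply/asboolP.
exact: pres_cong_trans uv vw.
Qed.

Canonical pres_eq_equiv :=
  EquivRel pres_eq pres_eq_refl pres_eq_sym pres_eq_trans.

Definition presented_monoid := {eq_quot pres_eq}.

HB.instance Definition _ := Choice.on presented_monoid.
HB.instance Definition _ := EqQuotient.on presented_monoid.

Definition word_class u : presented_monoid := \pi_presented_monoid u.

Lemma word_classP u v : reflect (pres_cong u v) (word_class u == word_class v).
Proof. by rewrite eqmodE; exact: asboolP. Qed.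

Lemma word_class_repr (x : presented_monoid) : word_class (repr x) = x.
Proof. exact: reprK. Qed.

Definition pres_mul (x y : presented_monoid) : presented_monoid :=
  word_class (repr x ++ repr y).

Definition pres_one : presented_monoid := word_class [::].

Lemma word_class_mul u v :
  pres_mul (word_class u) (word_class v) = word_class (u ++ v).
Proof.
have reprP w : pres_cong (repr (word_class w)) w.
  by apply/word_classP; rewrite word_class_repr.
by apply/eqP/word_classP; exact: pres_cong_cat.
Qed.

Lemma pres_mulA : associative pres_mul.
Proof.
move=> x y z; rewrite -[x]word_class_repr -[y]word_class_repr -[z]word_class_repr.
by rewrite !word_class_mul catA.
Qed.

Lemma pres_mul1 : left_id pres_one pres_mul.
Proof. by move=> x; rewrite -[x]word_class_repr word_class_mul. Qed.

Lemma pres_mulr1 : right_id pres_one pres_mul.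
Proof. by move=> x; rewrite -[x]word_class_repr word_class_mul cats0. Qed.

HB.instance Definition _ :=
  isMonoid.Build presented_monoid pres_mulA pres_mul1 pres_mulr1.

Definition pres_gen (a : A) : presented_monoid := word_class [:: a].

End PresentedMonoid.

(* The presentation < A | w = 1, w in ws >. *)
Definition special_rels (A : finType) (ws : seq (seq A)) :
  seq (seq A * seq A) := [seq (w, [::]) | w <- ws].

(* Main.v *)
Require Import Defs.
From mathcomp Require Import all_boot all_order.
From mathcomp Require Import boolp classical_sets functions cardinality.

Set Implicit Arguments.
Unset Strict Implicit.
Unset Printing Implicit Defensive.

Import Order.TTheory.

(* Let P be the submonoid of right units of M and E the set of pairs (r, a)   *)
(* with r in P, a in A and ra not in P. The letters act on the right on       *)
(* E^* x P: (t, r).a is (t, ra) if ra is in P and (t (r, a), 1) otherwise.    *)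
(* Prefixes of a relator are right units, so relators act trivially and M     *)
(* acts; m |-> (empty, 1).m is then a bijection from M to E^* x P. Its first  *)
(* coordinate only grows along the action, and it determines the R-class.     *)
(* Hence the poset of R-classes is E^* ordered by prefix, and the collapsed   *)
(* Cayley graph is the Cayley tree of the free monoid E^*.                    *)

(** The special form of the presentation is used in [foldl_step_cong]: relators fix every state, so
    each [m] has a well-defined state ([exits m], [tail m]), and [stateK] recovers [m] from it.
    Multiplying on the right only appends exits. Conversely, [tail m] has a right inverse, so from
    [m] one can return to the point where its component was entered and follow any continuation from
    there. Hence n is in mM exactly when [exits m] is a prefix of [exits n] ([prefix_exitsP]).

    Components and R-classes are therefore both indexed by exit words, and covering means appending
    one letter ([coversP]). An edge that survives the collapse appends its [label], and its source
    component together with its label determines it ([edge_inj]). So there are no parallel edges,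
    and a path from the root must spell the exit word of its endpoint. Every right unit is the tail
    of some element of each component ([state_exits_prod]), so the children of every vertex are in
    bijection with the same set E ([children_card]). *)

Lemma inj_surj_bijective (T U : Type) (f : T -> U) :
  injective f -> (forall y, exists x, f x = y) -> bijective f.
Proof.
move=> f_inj /choice[g fK]; exists g => // x.
exact/f_inj/fK.
Qed.

Lemma prefix_anti (T : eqType) (s t : seq T) : prefix s t -> prefix t s -> s = t.
Proof.
move=> st ts; have st_sz : size s = size t.
  by apply/eqP; rewrite eqn_leq !size_prefix.
by move: st; rewrite prefixE st_sz take_size => /eqP.
Qed.

Section SpecialMonoid.
Variables (A : finType) (ws : seq (seq A)).
Local Open Scope group_scope.
Local Notation M := (presented_monoid (special_rels ws)).
Local Notation gen := (@pres_gen A (special_rels ws)).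
Local Notation wc := (@word_class A (special_rels ws)).
Local Notation G := (right_cayley gen).
Implicit Types (m n r x : M) (a : A) (u v w : seq A) (t : seq (M * A)).

Lemma word_class_cat u v : wc (u ++ v) = wc u * wc v.
Proof. by rewrite [RHS]word_class_mul. Qed.

Lemma word_class_cons a u : wc (a :: u) = gen a * wc u.
Proof. exact: word_class_cat [:: a] u. Qed.

Lemma word_class_rcons u a : wc (rcons u a) = wc u * gen a.
Proof. by rewrite -cats1 word_class_cat. Qed.

Lemma pres_indl (P : M -> Prop) :
  P 1 -> (forall a m, P m -> P (gen a * m)) -> forall m, P m.
Proof.
move=> P1 Pa m; rewrite -[m]word_class_repr.
by elim: (repr m) => // a u Pu; rewrite word_class_cons; exact: Pa.
Qed.

Lemma pres_indr (P : M -> Prop) :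
  P 1 -> (forall m a, P m -> P (m * gen a)) -> forall m, P m.
Proof.
move=> P1 Pa m; rewrite -[m]word_class_repr.
by elim/last_ind: (repr m) => // u a Pu; rewrite word_class_rcons; exact: Pa.
Qed.

(** * Right units and the action of M on states *)

Definition right_unit x : bool := `[< exists y, x * y = 1 >].

Lemma right_unit1 : right_unit 1.
Proof. by apply/asboolP; exists 1; rewrite mulg1. Qed.

Lemma right_unitMl m n : right_unit (m * n) -> right_unit m.
Proof.
by move=> /asboolP[y mny]; apply/asboolP; exists (n * y); rewrite mulgA.
Qed.

(* The state (t, r) stands for (r_1 a_1) ... (r_k a_k) r where                *)
(* t = [:: (r_1, a_1); ...; (r_k, a_k)], r is a right unit and no r_i a_i is. *)
Definition step (s : seq (M * A) * M) a : seq (M * A) * M :=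
  if right_unit (s.2 * gen a) then (s.1, s.2 * gen a)
  else (rcons s.1 (s.2, a), 1).

Lemma right_unit_step s a : right_unit (step s a).2.
Proof. by rewrite /step; case: ifP => // _; exact: right_unit1. Qed.

Lemma right_unit_foldl_step s u :
  right_unit s.2 -> right_unit (foldl step s u).2.
Proof.
by elim: u s => //= a u IHu s _; apply/IHu/right_unit_step.
Qed.

(** A left factor of a right unit is a right unit, so no prefix of [u] triggers an exit. *)
Lemma foldl_step_right_unit t r u : right_unit (r * wc u) ->
  foldl step (t, r) u = (t, r * wc u).
Proof.
elim: u r => [r _|a u IHu r]; first by rewrite [wc [::]]/(1 : M) mulg1.
rewrite word_class_cons mulgA => rau /=.
by rewrite /step /= (right_unitMl rau) IHu.
Qed.

Lemma word_class_relator w : w \in ws -> wc w = 1.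
Proof.
move=> w_ws; apply/eqP/word_classP/pres_cong_rel.
by apply/mapP; exists w.
Qed.

Lemma foldl_step_cong u v s : pres_cong (special_rels ws) u v ->
  right_unit s.2 -> foldl step s u = foldl step s v.
Proof.
move=> uv; elim: uv s => {u v}.
- move=> u v /mapP[w w_ws [-> ->]] [t r] /= r_unit.
  (* Since [w] equals 1 in M, r w = r is a right unit: reading [w] never exits and ends back at
     r. *)
  by rewrite foldl_step_right_unit word_class_relator ?mulg1.
- by [].
- by move=> u v _ IH s /IH.
- by move=> u v w _ IH1 _ IH2 s rs; rewrite IH1 // IH2.
- move=> u u' v v' _ IHu _ IHv s rs; rewrite !foldl_cat IHu // IHv //.
  exact: right_unit_foldl_step.
Qed.

(** * The normal form of an element: exit word and right-unit tail *)

Definition state m := foldl step ([::], 1 : M) (repr m).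
Definition exits m := (state m).1.
Definition tail m := (state m).2.

Lemma state_word u : state (wc u) = foldl step ([::], 1 : M) u.
Proof.
apply: foldl_step_cong; last exact: right_unit1.
by apply/word_classP; rewrite word_class_repr.
Qed.

Lemma state1 : state 1 = ([::], 1).
Proof. exact: state_word [::]. Qed.

Lemma state_foldl m u : state (m * wc u) = foldl step (state m) u.
Proof.
by rewrite -[m in LHS]word_class_repr -word_class_cat state_word foldl_cat.
Qed.

Lemma state_gen m a : state (m * gen a) = step (state m) a.
Proof. exact: state_foldl m [:: a]. Qed.

Lemma right_unit_tail m : right_unit (tail m).
Proof. exact/right_unit_foldl_step/right_unit1. Qed.

Lemma state_mul m x : right_unit (tail m * x) ->
  state (m * x) = (exits m, tail m * x).
Proof.
rewrite -[x]word_class_repr state_foldl [state m]surjective_pairing.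
exact: foldl_step_right_unit.
Qed.

Lemma exits_gen_in m a :
  right_unit (tail m * gen a) -> exits (m * gen a) = exits m.
Proof. by move=> ra; rewrite /exits state_gen /step -/(tail m) ra. Qed.

Lemma exits_gen_out m a : ~~ right_unit (tail m * gen a) ->
  exits (m * gen a) = rcons (exits m) (tail m, a).
Proof.
by move=> ra; rewrite /exits state_gen /step -/(tail m) (negPf ra).
Qed.

Definition exits_prod t : M := foldr (fun e x => e.1 * gen e.2 * x) 1 t.

Lemma exits_prod_cat s t : exits_prod (s ++ t) = exits_prod s * exits_prod t.
Proof. by elim: s => [|e s IHs] /=; rewrite ?mul1g // IHs mulgA. Qed.

Lemma stateK m : exits_prod (exits m) * tail m = m.
Proof.
elim/pres_indr: m => [|m a IHm].
  by rewrite /exits /tail state1 /= mulg1.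
rewrite /exits /tail state_gen /step -/(exits m) -/(tail m).
case: ifP => _ /=; first by rewrite mulgA IHm.
by rewrite mulg1 -cats1 exits_prod_cat /= mulg1 mulgA IHm.
Qed.

Lemma state_inj m n : exits m = exits n -> tail m = tail n -> m = n.
Proof. by move=> emn tmn; rewrite -[m]stateK emn tmn stateK. Qed.

(** Cancelling the tail on the right leads back to the entry point of the component of [m]. *)
Lemma exits_prod_exits m : exists2 y, tail m * y = 1 & exits_prod (exits m) = m * y.
Proof.
have /asboolP[y my] := right_unit_tail m.
by exists y => //; rewrite -{2}[m]stateK -mulgA my mulg1.
Qed.

Lemma state_exits_prod m r : right_unit r ->
  state (exits_prod (exits m) * r) = (exits m, r).
Proof.
have [y my ->] := exits_prod_exits m => r_unit.
by rewrite -mulgA state_mul mulgA my mul1g.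
Qed.

(** * Reachability and the R-order as the prefix order on exit words *)

Lemma prefix_exits m x : prefix (exits m) (exits (m * x)).
Proof.
elim/pres_indr: x => [|x a IHx]; first by rewrite mulg1 prefix_refl.
rewrite mulgA; apply: prefix_trans IHx _.
have [/exits_gen_in->|/exits_gen_out->] := boolP (right_unit (tail (m * x) * gen a)).
  exact: prefix_refl.
exact: prefix_rcons.
Qed.

Lemma prefix_exitsP m n :
  reflect (exists x, n = m * x) (prefix (exits m) (exits n)).
Proof.
apply: (iffP idP) => [/prefixP[t nt]|[x ->]]; last exact: prefix_exits.
have [y _ my] := exits_prod_exits m.
(* Go back from [m] to its entry point, then take the remaining exits and the tail of [n]. *)
exists (y * (exits_prod t * tail n)).
by rewrite mulgA -my mulgA -exits_prod_cat -nt stateK.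
Qed.

Lemma reachesP m n : @reaches G m n <-> prefix (exits m) (exits n).
Proof.
split=> [[p]|/prefix_exitsP[x ->{n}]].
  elim: p m => [m <-|[m' a] p IHp m /= [-> /IHp]]; first exact: prefix_refl.
  exact/prefix_trans/prefix_exits.
elim/pres_indl: x m => [|a x IHx] m; first by exists [::]; rewrite mulg1.
by have [p mp] := IHx (m * gen a); exists ((m, a) :: p); rewrite mulgA.
Qed.

Lemma sccP m n : @scc G m = @scc G n <-> exits m = exits n.
Proof.
split=> [/eqP|mn].
  by rewrite eqmodE => /asboolP[/reachesP mn /reachesP nm]; exact: prefix_anti.
by apply/eqP; rewrite eqmodE; apply/asboolP; split; apply/reachesP;
  rewrite mn prefix_refl.
Qed.

Lemma Rclass_leP m n :
  (Rclass n <= Rclass m)%O = prefix (exits m) (exits n).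
Proof.
rewrite Rclass_le; apply/asboolP/prefix_exitsP => [nm|[x ->] _ [y _ <-]].
  by have [|x _ <-] := nm n; [exists 1; rewrite ?mulg1|exists x].
by exists (x * y); rewrite ?mulgA.
Qed.

Lemma Rclass_eqP m n : Rclass m = Rclass n <-> exits m = exits n.
Proof.
split=> [mn|mn].
  by apply: prefix_anti; rewrite -Rclass_leP mn lexx.
by apply: le_anti; rewrite !Rclass_leP mn prefix_refl.
Qed.

(** Letters that keep the tail a right unit leave the exit word unchanged, so its last letter was
    recorded at the most recent exit; [m] is the element just before that exit. *)
Lemma exits_rcons n t e : exits n = rcons t e ->
  exists m a, [/\ exits m = t, e = (tail m, a) & ~~ right_unit (tail m * gen a)].
Proof.
elim/pres_indr: n => [|n a IHn]; first by rewrite /exits state1; case: t.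
have [/exits_gen_in-> //|ra] := boolP (right_unit (tail n * gen a)).
rewrite exits_gen_out // => /rcons_inj[nt ne].
by exists n, a; split.
Qed.

Lemma exits_prefix_closed n t : prefix t (exits n) -> exists m, exits m = t.
Proof.
move=> /prefixP[s]; elim/last_ind: s n => [|s e IHs] n nts.
  by exists n; rewrite nts cats0.
by move: nts; rewrite -rcons_cat => /exits_rcons[m [a [/IHs]]].
Qed.

Lemma Rclass_ltP m n : (Rclass n < Rclass m)%O <->
  exists e t, exits n = exits m ++ e :: t.
Proof.
rewrite lt_neqAle Rclass_leP; split=> [/andP[nm /prefixP[[|e t] nE]]|[e [t nE]]].
- by case/eqP: nm; apply/Rclass_eqP; rewrite nE cats0.
- by exists e, t.
apply/andP; split; last by rewrite nE prefix_prefix.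
apply/eqP => /Rclass_eqP /(congr1 size)/eqP.
by rewrite nE size_cat /= -[X in _ == X]addn0 eqn_add2l.
Qed.

Lemma Rclass_surj (y : Rquot M) : exists m, y = Rclass m.
Proof. by exists (repr y); rewrite /Rclass reprK. Qed.

Lemma coversP m n :
  covers (Rclass m) (Rclass n) <-> exists e, exits n = rcons (exits m) e.
Proof.
split=> [[/Rclass_ltP[e [t nE]] no_mid]|[e nE]].
  case: t nE => [|e' t] nE; first by exists e; rewrite nE cats1.
  (* If two or more letters were appended, stopping after the first gives a class strictly in
     between. *)
  have [k kE] : exists k, exits k = rcons (exits m) e.
    by apply: (@exits_prefix_closed n); rewrite nE -cat_rcons prefix_prefix.
  case: no_mid; exists (Rclass k); split; apply/Rclass_ltP.
    by exists e', t; rewrite kE cat_rcons.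
  by exists e, [::]; rewrite kE cats1.
split; first by apply/Rclass_ltP; exists e, [::]; rewrite nE cats1.
move=> [z]; have [k ->{z}] := Rclass_surj z => -[].
move=> /Rclass_ltP[e1 [t1 nk]] /Rclass_ltP[e2 [t2 km]].
move: nE; rewrite nk km => /(congr1 size)/eqP.
by rewrite !size_cat size_rcons /= -addnA -[X in _ == X]addn1 eqn_add2l addnS.
Qed.

(** * The collapsed Cayley graph: tree structure, children and Hasse diagram *)

Local Notation Gamma := (condensation G).

Lemma scc_gen_neq m a :
  (@scc G m != @scc G (m * gen a)) = ~~ right_unit (tail m * gen a).
Proof.
apply/idP/idP => [/eqP neq|ra].
  by apply/negP => ra; apply/neq/sccP; rewrite exits_gen_in.
apply/eqP => /sccP; rewrite exits_gen_out // => /(congr1 size)/eqP.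
by rewrite size_rcons -addn1 -[X in X == _]addn0 eqn_add2l.
Qed.

Lemma scc_surj (c : vertex Gamma) : exists m, c = @scc G m.
Proof. by exists (repr c); rewrite /scc /scc_type reprK. Qed.

Definition label (x : edge Gamma) : M * A := (tail (sval x).1, (sval x).2).

Lemma exits_target (x : edge Gamma) :
  exits ((sval x).1 * gen (sval x).2) = rcons (exits (sval x).1) (label x).
Proof.
case: x => -[m a] /= ra; rewrite exits_gen_out //.
by rewrite -scc_gen_neq.
Qed.

Lemma edge_inj (x y : edge Gamma) :
  exits (sval x).1 = exits (sval y).1 -> label x = label y -> x = y.
Proof.
move=> exy [txy axy]; apply: val_inj => /=.
by rewrite [LHS]surjective_pairing [RHS]surjective_pairing axy (state_inj exy txy).
Qed.

Lemma edge_exists m e t : exits m = rcons t e ->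
  exists x : edge Gamma, exits (sval x).1 = t /\ label x = e.
Proof.
move=> /exits_rcons[m' [a [m't -> ra]]].
have ma : @scc G m' != @scc G (m' * gen a) by rewrite scc_gen_neq.
by exists (exist _ (m', a) ma).
Qed.

Lemma exits_dipath m n p :
  @dipath Gamma (@scc G m) p (@scc G n) -> exits n = exits m ++ map label p.
Proof.
elim: p m => [m /sccP->|x p IHp m /= [/sccP xm /IHp ->]]; first by rewrite cats0.
by rewrite /= exits_target xm cat_rcons.
Qed.

(** By [edge_inj], the component reached so far and the next label determine the next edge. *)
Lemma dipath_label_inj m c p q :
  @dipath Gamma (@scc G m) p c -> @dipath Gamma (@scc G m) q c ->
  map label p = map label q -> p = q.
Proof.
elim: p q m => [|x p IHp] [|y q] m //= [/sccP xm xp] [/sccP ym yq] pq.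
have xy : x = y.
  by apply: edge_inj (congr1 (head (label x)) pq); exact: etrans xm (esym ym).
move: pq yq; rewrite -xy => /(congr1 behead) pq yq.
by congr cons; exact: IHp xp yq pq.
Qed.

Lemma condensation_rooted_tree : @rooted_tree Gamma (@scc G (1 : M)).
Proof.
move=> c; have [m {c}->] := scc_surj c.
suff [p pm] : exists p, @dipath Gamma (@scc G (1 : M)) p (@scc G m).
  exists p; split=> // q qm; apply: (dipath_label_inj pm qm).
  (* The exit word of 1 is empty, so both paths spell [exits m]. *)
  by move: (exits_dipath qm); rewrite (exits_dipath pm) /exits state1.
elim/pres_indr: m => [|m a [p pm]]; first by exists [::].
have [ma|ma] := eqVneq (@scc G m) (@scc G (m * gen a)).
  (* An internal edge disappears in the collapse, so the old path still works. *)
  by exists p; rewrite -ma.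
by exists (p ++ [:: exist _ (m, a) ma]); apply: dipath_cat pm _.
Qed.

Lemma children_card m :
  (@children Gamma (@scc G m) #=
   [set e : M * A | right_unit e.1 /\ ~~ right_unit (e.1 * gen e.2)]%classic)%card.
Proof.
(* For a right unit [e.1], this is the unique element of the component of [m] with tail [e.1]. *)
pose k (e : M * A) := exits_prod (exits m) * e.1.
have kE e : right_unit e.1 -> exits (k e) = exits m /\ tail (k e) = e.1.
  by move=> re; rewrite /exits /tail state_exits_prod.
set E := [set _ | _]%classic; pose f e : vertex Gamma := @scc G (k e * gen e.2).
have -> : @children Gamma (@scc G m) = [set f e | e in E]%classic.
  apply/seteqP; split=> [_ [x [/sccP xm <-]]|_ [e [re rea] <-]].
    have rx := right_unit_tail (sval x).1.
    have [kx tx] := kE (label x) rx.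
    (* [k (label x)] has the exits and the tail of the source of [x], hence equals it. *)
    exists (label x).
      split=> //=; rewrite -scc_gen_neq; exact: (svalP x).
    by rewrite /f (state_inj (etrans kx (esym xm)) tx).
  have [ke te] := kE e re.
  have ka : @scc G (k e) != @scc G (k e * gen e.2) by rewrite scc_gen_neq te.
  by exists (exist _ (k e, e.2) ka); split=> //; apply/sccP.
apply: inj_card_eq => e e' /set_mem[re rea] /set_mem[re' rea'] /sccP.
have [ke te] := kE e re; have [ke' te'] := kE e' re'.
rewrite !exits_gen_out ?te ?te' // ke ke' => /rcons_inj[].
by case: e e' {re rea ke te re' rea' ke' te'} => [r a] [r' a'] /= -> ->.
Qed.

Lemma condensation_hasse : digraph_isomorphic Gamma (hasse_ge (Rquot M)).
Proof.
pose f (c : vertex Gamma) : Rquot M := Rclass (repr c).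
have fE m : f (@scc G m) = Rclass m.
  by apply/Rclass_eqP/sccP; rewrite /scc /scc_type reprK.
have gP (x : edge Gamma) : covers (f (source x)) (f (target x)).
  by rewrite !fE; apply/coversP; exists (label x); rewrite exits_target.
pose g (x : edge Gamma) : edge (hasse_ge (Rquot M)) := exist _ (_, _) (gP x).
exists f, g; split=> //.
  apply: inj_surj_bijective => [c c'|y].
    have [[m ->] [m' ->]] := (scc_surj c, scc_surj c').
    by rewrite !fE => /Rclass_eqP/sccP.
  by have [m ->] := Rclass_surj y; exists (@scc G m).
(* Injectivity on edges excludes parallel edges: the exit words of the two ends determine the
   label. *)
apply: inj_surj_bijective => [x y [] |[[y z] yz]].
  rewrite !fE => /Rclass_eqP exy /Rclass_eqP.
  rewrite !exits_target exy => /rcons_inj[txy axy].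
  exact: edge_inj exy (congr2 pair txy axy).
have [[m my] [n nz]] := (Rclass_surj y, Rclass_surj z).
have /coversP[e nE] : covers (Rclass m) (Rclass n) by rewrite -my -nz.
have [x [xm xe]] := edge_exists nE.
exists x; apply: eq_exist; rewrite /= !fE my nz.
by congr pair; apply/Rclass_eqP; rewrite // exits_target xm xe.
Qed.

End SpecialMonoid.

Theorem theorem3p14 (A : finType) (ws : seq (seq A)) :
  let M : monoidType := presented_monoid (special_rels ws) in
  let CayleyG := right_cayley (@pres_gen A (special_rels ws)) in
  let Gamma := condensation CayleyG in
  digraph_isomorphic Gamma (hasse_ge (Rquot M)) /\
  @regular_rooted_tree Gamma (@scc CayleyG (1%g : M)).
Proof.
move=> M CayleyG Gamma; split; first exact: condensation_hasse.
split=> [|c c']; first exact: condensation_rooted_tree.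
have [[m ->] [m' ->]] := (scc_surj c, scc_surj c').
apply: card_eq_trans (children_card m) _.
by rewrite card_eq_sym; exact: children_card.
Qed.
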